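(* Let $X,Y$ be computable metric spaces and let $X$ be complete. If $f:X\to Y$ is limit computable and continuous, then $f$ is computable relative to some hyperarithmetical oracle (i.e., an oracle $q\in\mathbb{N}^{\mathbb{N}}$ in $\Delta^1_1$).
   Context: A computable metric space $(X,d,\alpha)$ is a metric space $(X,d)$ with a dense sequence $\alpha:\mathbb{N}\to X$ such that $d\circ(\alpha\times\alpha):\mathbb{N}^2\to\mathbb{R}$ is a computable (double) sequence of reals. It is represented by its Cauchy representation $\delta_X:\subseteq\mathbb{N}^{\mathbb{N}}\to X$, $\delta_X(p):=\lim_{n\to\infty}\alpha p(n)$ with $\mathrm{dom}(\delta_X)=\{p:(\forall k)(\forall n\geq k)\;d(\alpha p(n),\alpha p(k))<2^{-k}$ and $(\alpha p(n))_n$ converges$\}$. A function $f:X\to Y$ is limit computable, or computable relative to an oracle $q$, if it has a realizer with that property, i.e. such an $F:\subseteq\mathbb{N}^{\mathbb{N}}\to\mathbb{N}^{\mathbb{N}}$ with $\delta_YF(p)=f\delta_X(p)$ for all $p\in\mathrm{dom}(\delta_X)$. A partial function $F:\subseteq\mathbb{N}^{\mathbb{N}}\to\mathbb{N}^{\mathbb{N}}$ is computable if there is a Turing machine (infinite input tape, one-way output tape) that on each $p\in\mathrm{dom}(F)$ produces $F(p)$ in the long run; it is limit computable if there is a Turing machine with a two-way output tape (it may revise its output) that on each $p\in\mathrm{dom}(F)$ computes $F(p)$ such that each output position $n$ has, after finitely many steps, the content $F(p)(n)$ and is never changed again; it is computable relative to $q\in\mathbb{N}^{\mathbb{N}}$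 if there is a computable $G$ with $F(p)=G\langle q,p\rangle$ for all $p\in\mathrm{dom}(F)$, where $\langle q,p\rangle(2n):=q(n)$, $\langle q,p\rangle(2n+1):=p(n)$. Nothing is required outside $\mathrm{dom}(F)$. *)

(* Defs.v *)
From HB Require Import structures.
From mathcomp Require Import all_boot all_order all_algebra.
From mathcomp Require Import boolp classical_sets reals topology.

Set Implicit Arguments.
Unset Strict Implicit.
Unset Printing Implicit Defensive.

Import Order.TTheory GRing.Theory Num.Theory.

Definition baire := nat -> nat.

(** ** Turing machines on infinite inputs *)

(** A point [p] of Baire space is written on a tape over a two-letter alphabet
    in unary, as [1^{p 0} 0 1^{p 1} 0 1^{p 2} 0 ...] with [true] for [1] and
    [false] for [0].  The first [i.+1] blocks have at least [i.+1] letters, so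
    the default value of [nth] is never used. *)
Definition encode (p : baire) (i : nat) : bool :=
  nth false (flatten [seq rcons (nseq (p k) true) false | k <- iota 0 i.+1]) i.

Inductive move := Left | Stay | Right.

(** Tapes are infinite to the right only; a left move from cell 0 does nothing. *)
Definition shift (m : move) (h : nat) : nat :=
  match m with Left => h.-1 | Stay => h | Right => h.+1 end.

Record tape (A : Type) := Tape { cell : nat -> A; position : nat }.

Definition scan (A : Type) (t : tape A) : A := cell t (position t).

Definition write (A : Type) (t : tape A) (am : A * move) : tape A :=
  Tape (fun i => if i == position t then am.1 else cell t i) (shift am.2 (position t)).

(** A machine has a read-only input tape, finitely many work tapes and an
    output tape with cells in [option bool], [None] being the blank.  One step
    depends on the state, the input letter, the scanned work letters and the
    scanned output cell.  Since outputs are infinite there is no halting: a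
    machine may instead loop without moving. *)
Record machine := Machine {
  state : finType;
  start : state;
  letter : finType;
  blank : letter;
  ntapes : nat;
  trans : state -> bool -> {ffun 'I_ntapes -> letter} -> option bool ->
    state * move * {ffun 'I_ntapes -> letter * move} * (option bool * move)
}.

Record config (M : machine) := Config {
  cstate : state M;
  cin : nat;
  cwork : 'I_(ntapes M) -> tape (letter M);
  cout : tape (option bool)
}.

Definition init (M : machine) : config M :=
  Config (start M) 0 (fun=> Tape (fun=> blank M) 0) (Tape (fun=> None) 0).

Definition step (M : machine) (p : baire) (c : config M) : config M :=
  let: (s, mi, w, o) := trans (cstate c) (encode p (cin c))
                              [ffun j => scan (cwork c j)] (scan (cout c)) in
  Config s (shift mi (cin c)) (fun j => write (cwork c j) (w j))
         (write (cout c) o).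

Definition run (M : machine) (p : baire) (t : nat) : config M :=
  iter t (step p) (init M).

(** Every output cell eventually holds its final, correct letter. *)
Definition produces (M : machine) (p r : baire) : Prop :=
  forall i, exists t0, forall t, t0 <= t ->
    cell (cout (run M p t)) i = Some (encode r i).

(** One-way output: each step either leaves the output tape untouched or writes
    a letter and moves right, so that nothing written is ever revised. *)
Definition one_way (M : machine) : Prop :=
  forall (s : state M) (a : bool) (w : {ffun 'I_(ntapes M) -> letter M})
         (c : option bool),
    let: o := (trans s a w c).2 in
    o = (c, Stay) \/ exists b : bool, o = (Some b, Right).

(** ** Computability of partial functions on Baire space *)

Definition pfun_baire := baire -> option baire.

Definition computable (F : pfun_baire) : Prop :=
  exists M : machine, one_way M /\
    forall p r : baire, F p = Some r -> produces M p r.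

Definition limit_computable (F : pfun_baire) : Prop :=
  exists M : machine, forall p r : baire, F p = Some r -> produces M p r.

Definition interleave (q p : baire) : baire :=
  fun n => if odd n then p n./2 else q n./2.

Definition computable_rel (q : baire) (F : pfun_baire) : Prop :=
  exists G : pfun_baire, computable G /\
    forall p r : baire, F p = Some r -> G (interleave q p) = Some r.

Definition computable_seq (a : baire) : Prop := computable (fun=> Some a).

(** ** Hyperarithmetical oracles *)

(** First-order arithmetic with one free function variable [X]; number
    variables are de Bruijn indices. *)
Inductive term :=
| Var of nat
| Zero
| Succ of term
| Add of term & term
| Mul of term & term
| App of term.

Inductive formula :=
| Eq of term & term
| Not of formula
| And of formula & formula
| All of formula.

Fixpoint teval (X : baire) (e : seq nat) (t : term) : nat :=
  match t with
  | Var i => nth 0 e i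
  | Zero => 0
  | Succ t => (teval X e t).+1
  | Add t u => teval X e t + teval X e u
  | Mul t u => teval X e t * teval X e u
  | App t => X (teval X e t)
  end.

Fixpoint holds (X : baire) (e : seq nat) (phi : formula) : Prop :=
  match phi with
  | Eq t u => teval X e t = teval X e u
  | Not phi => ~ holds X e phi
  | And phi psi => holds X e phi /\ holds X e psi
  | All phi => forall n, holds X (n :: e) phi
  end.

Definition Sigma11 (A : nat -> nat -> Prop) : Prop :=
  exists phi : formula, forall n m,
    A n m <-> exists X : baire, holds X [:: n; m] phi.

Definition Pi11 (A : nat -> nat -> Prop) : Prop :=
  Sigma11 (fun n m => ~ A n m).

Definition hyperarithmetical (q : baire) : Prop :=
  let graph n m := q n = m in Sigma11 graph /\ Pi11 graph.

(** ** Computable metric spaces *)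

Local Open Scope classical_set_scope.
Local Open Scope ring_scope.

Definition cantor_pair (i j : nat) : nat := ('C((i + j).+1, 2) + j)%N.

Definition computable_double_seq (R : realType) (r : nat -> nat -> R) : Prop :=
  exists s a b : baire,
    [/\ computable_seq s, computable_seq a, computable_seq b &
      forall i j k, let n := cantor_pair (cantor_pair i j) k in
        b n <> 0%N /\
        `|r i j - (-1) ^+ s n * ((a n)%:R / (b n)%:R)| <= 2 ^- k].

Definition computable_metric (R : realType) (X : metricType R)
    (alpha : nat -> X) : Prop :=
  dense (range alpha) /\
  computable_double_seq (fun i j => mdist (alpha i) (alpha j)).

(** [complete] rather than the library's [completeType], which is only
    available jointly with a distinguished point. *)
Definition complete (T : uniformType) : Prop :=
  forall F : set_system T, ProperFilter F -> cauchy F ->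
    exists x : T, F --> x.

(** [cauchy_name alpha p x]: [p] is in the domain of the Cauchy representation
    and represents [x]. *)
Definition cauchy_name (R : realType) (X : metricType R) (alpha : nat -> X)
    (p : baire) (x : X) : Prop :=
  (forall k n, (k <= n)%N -> mdist (alpha (p n)) (alpha (p k)) < 2 ^- k) /\
  (fun n => alpha (p n)) @ \oo --> x.

Definition realizer (R : realType) (X Y : metricType R)
    (alpha : nat -> X) (beta : nat -> Y) (F : pfun_baire) (f : X -> Y) : Prop :=
  forall (p : baire) (x : X), cauchy_name alpha p x ->
    exists2 r : baire, F p = Some r & cauchy_name beta r (f x).

Definition limit_computable_map (R : realType) (X Y : metricType R)
    (alpha : nat -> X) (beta : nat -> Y) (f : X -> Y) : Prop :=
  exists F : pfun_baire, realizer alpha beta F f /\ limit_computable F.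

Definition computable_map_rel (q : baire) (R : realType) (X Y : metricType R)
    (alpha : nat -> X) (beta : nat -> Y) (f : X -> Y) : Prop :=
  exists F : pfun_baire, realizer alpha beta F f /\ computable_rel q F.

(* Main.v *)
From HB Require Import structures.
Require Import Defs.
From mathcomp Require Import all_boot all_order all_algebra.
From mathcomp Require Import boolp classical_sets reals topology.
From mathcomp Require Import zify ring lra.

(** A continuous [f] is controlled by its values on the dense sequence: if all
    [alpha n] in an open ball are mapped close to [beta j], then so is the whole
    ball.  Running the limit machine on the constant names of the points
    [alpha n] gives names [r n] of [f (alpha n)], so the statement "every
    [alpha n] with [d (alpha n, alpha i) < 2 ^- l] is mapped close to [beta j]"
    is arithmetical.  A machine with an oracle [q] answering such questions
    reads a name [p] of [x] and prints the next index [j] as soon as some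
    [p l] guarantees it; by continuity this happens for every precision.
    Since [q] may be any hyperarithmetical sequence, it is chosen to be the
    complete transition table of this search, and one fixed small machine
    interprets it. *)

Set Implicit Arguments.
Unset Strict Implicit.
Unset Printing Implicit Defensive.

(** * Arithmetical and implicitly defined functions *)

(** An injective pairing that is a term of the language, so that a function
    variable can hold a family of tables; it is not surjective, and [0] codes
    [(0, 0)]. *)
Definition pr (a b : nat) : nat := (a + b) * (a + b) + a.

Lemma pr_inj a b c d : pr a b = pr c d -> a = c /\ b = d.
Proof.
rewrite /pr => E.
have [H|H|H] := ltngtP (a + b) (c + d); last by nia.
- have : (a + b).+1 * (a + b).+1 <= (c + d) * (c + d) by rewrite leq_mul.
  by nia.
- have : (c + d).+1 * (c + d).+1 <= (a + b) * (a + b) by rewrite leq_mul.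
  by nia.
Qed.

Definition tup (c x y z : nat) : nat := pr c (pr x (pr y z)).

Lemma tup_inj c x y z c' x' y' z' : tup c x y z = tup c' x' y' z' ->
  [/\ c = c', x = x', y = y' & z = z'].
Proof. by move=> /pr_inj[-> /pr_inj[-> /pr_inj[-> ->]]]. Qed.

(** The bound variable of an arithmetical quantifier is the head of the
    environment; the closure lemmas below are stated so that [apply] turns a
    Rocq binder into that head. *)
Definition dterm (f : baire -> seq nat -> nat) : Prop :=
  exists t, forall X e, teval X e t = f X e.

Definition definable (P : baire -> seq nat -> Prop) : Prop :=
  exists phi, forall X e, holds X e phi <-> P X e.

Lemma dterm_const n : dterm (fun _ _ => n).
Proof.
exists (iter n Succ Zero) => X e; elim: n => //= n ->; done.
Qed.

Lemma dterm_head : dterm (fun _ e => head 0 e).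
Proof. by exists (Var 0) => X [|]. Qed.

(** One substitution serves two purposes: [s] shifts number variables, and [r] redirects the
    argument of the function variable to a column. *)
Fixpoint tsub (s : nat -> term) (r : term -> term) (t : term) : term :=
  match t with
  | Var i => s i
  | Zero => Zero
  | Succ t => Succ (tsub s r t)
  | Add t u => Add (tsub s r t) (tsub s r u)
  | Mul t u => Mul (tsub s r t) (tsub s r u)
  | App t => App (r (tsub s r t))
  end.

Lemma dterm_behead f : dterm f -> dterm (fun X e => f X (behead e)).
Proof.
move=> [t Ht]; exists (tsub (fun i => Var i.+1) id t) => X e.
rewrite -Ht; elim: t {Ht} => //= [i|t ->|t -> u ->|t -> u ->|t ->] //.
by rewrite nth_behead.
Qed.

Lemma dterm_succ f : dterm f -> dterm (fun X e => (f X e).+1).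
Proof. by move=> [t Ht]; exists (Succ t) => X e /=; rewrite Ht. Qed.

Lemma dterm_add f g : dterm f -> dterm g -> dterm (fun X e => f X e + g X e).
Proof. by move=> [t Ht] [u Hu]; exists (Add t u) => X e /=; rewrite Ht Hu. Qed.

Lemma dterm_mul f g : dterm f -> dterm g -> dterm (fun X e => f X e * g X e).
Proof. by move=> [t Ht] [u Hu]; exists (Mul t u) => X e /=; rewrite Ht Hu. Qed.

Lemma dterm_app f : dterm f -> dterm (fun X e => X (f X e)).
Proof. by move=> [t Ht]; exists (App t) => X e /=; rewrite Ht. Qed.

Lemma dterm_pr f g : dterm f -> dterm g -> dterm (fun X e => pr (f X e) (g X e)).
Proof. by move=> Hf Hg; do !apply: dterm_add => //; apply: dterm_mul; apply: dterm_add. Qed.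

Lemma dterm_tup f g h k : dterm f -> dterm g -> dterm h -> dterm k ->
  dterm (fun X e => tup (f X e) (g X e) (h X e) (k X e)).
Proof. by move=> Hf Hg Hh Hk; do 3!apply: dterm_pr => //. Qed.

Lemma def_eq f g : dterm f -> dterm g -> definable (fun X e => f X e = g X e).
Proof. by move=> [t Ht] [u Hu]; exists (Eq t u) => X e /=; rewrite Ht Hu. Qed.

Lemma def_ext P Q : (forall X e, P X e <-> Q X e) -> definable P -> definable Q.
Proof. by move=> PQ [phi H]; exists phi => X e; rewrite H. Qed.

Lemma def_not P : definable P -> definable (fun X e => ~ P X e).
Proof. by move=> [phi H]; exists (Not phi) => X e /=; rewrite H. Qed.

Lemma def_and P Q : definable P -> definable Q ->
  definable (fun X e => P X e /\ Q X e).
Proof. by move=> [phi H] [psi K]; exists (And phi psi) => X e /=; rewrite H K. Qed.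

Lemma def_all (P : baire -> seq nat -> nat -> Prop) :
  definable (fun X e => P X (behead e) (head 0 e)) ->
  definable (fun X e => forall n, P X e n).
Proof.
by move=> [phi H]; exists (All phi) => X e /=; split=> K n; move: (K n); rewrite H.
Qed.

Lemma def_or P Q : definable P -> definable Q ->
  definable (fun X e => P X e \/ Q X e).
Proof.
move=> dP dQ; apply: def_ext (def_not (def_and (def_not dP) (def_not dQ))) => X e.
by split=> [H|[] H []//]; have [|?] := pselect (P X e); [left|right; apply: contrapT => ?; apply: H].
Qed.

Lemma def_imp P Q : definable P -> definable Q ->
  definable (fun X e => P X e -> Q X e).
Proof.
move=> dP dQ; apply: def_ext (def_not (def_and dP (def_not dQ))) => X e.
by split=> [H p|H [p]]; [apply: contrapT => ?; apply: H|apply; apply: H].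
Qed.

Lemma def_if (b : bool) P Q : definable P -> definable Q ->
  definable (fun X e => if b then P X e else Q X e).
Proof. by case: b. Qed.

Lemma def_ex (P : baire -> seq nat -> nat -> Prop) :
  definable (fun X e => P X (behead e) (head 0 e)) ->
  definable (fun X e => exists n, P X e n).
Proof.
move=> dP; apply: (@def_ext (fun X e => ~ forall n, ~ P X e n)).
  move=> X e; split=> [H|[n p] /(_ n)//].
  by apply: contrapT => K; apply: H => n p; apply: K; exists n.
by apply: def_not; apply: def_all; apply: def_not.
Qed.

Lemma def_const (A : Prop) : definable (fun _ _ => A).
Proof.
have [a|a] := pselect A; [exists (Eq Zero Zero)|exists (Not (Eq Zero Zero))] => X e /=;
  by split => // H; case: H.
Qed.

(** The quantifier unfolds into a finite conjunction, so the states and letters of a machine need no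
    number quantifier. *)
Lemma def_fin_all (T : finType) (P : T -> baire -> seq nat -> Prop) :
  (forall x, definable (P x)) -> definable (fun X e => forall x, P x X e).
Proof.
move=> dP; apply: (@def_ext (fun X e => forall x, x \in enum T -> P x X e)).
  by move=> X e; split=> H x => [|_]; apply: H; rewrite mem_enum.
elim: (enum T) => [|y s IH].
  by apply: def_ext (def_const True) => X e; split.
apply: def_ext (def_and (dP y) IH) => X e; split.
  by move=> [Hy Hs] x; rewrite inE => /orP[/eqP ->//|]; apply: Hs.
by move=> H; split=> [|x xs]; apply: H; rewrite inE ?eqxx ?xs ?orbT.
Qed.

Lemma def_le f g : dterm f -> dterm g -> definable (fun X e => f X e <= g X e).
Proof.
move=> df dg; apply: (@def_ext (fun X e => exists n, f X e + n = g X e)).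
  by move=> X e; split=> [[n <-]|H]; [lia|exists (g X e - f X e); lia].
by apply: def_ex; apply: def_eq; [apply: dterm_add; [apply: dterm_behead|apply: dterm_head]|apply: dterm_behead].
Qed.

Fixpoint fsub (r : term -> term) (phi : formula) : formula :=
  match phi with
  | Eq t u => Eq (tsub Var r t) (tsub Var r u)
  | Not phi => Not (fsub r phi)
  | And phi psi => And (fsub r phi) (fsub r psi)
  | All phi => All (fsub r phi)
  end.

Definition column (X : baire) (c : nat) : baire := fun n => X (pr c n).

Lemma def_column P c : definable P -> definable (fun X e => P (column X c) e).
Proof.
have [k Hk] := dterm_const c.
(* This is [pr c t] written out as a term. *)
pose r t := Add (Mul (Add k t) (Add k t)) k.
have Ht X e t : teval X e (tsub Var r t) = teval (column X c) e t.
  by elim: t => //= [t ->|t -> u ->|t -> u ->|t ->] //; rewrite Hk.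
move=> [phi H]; exists (fsub r phi) => X e; rewrite -H {H}.
elim: phi e => //= [t u|phi IH|phi IH psi IH'|phi IH] e.
- by rewrite !Ht.
- by rewrite IH.
- by rewrite IH IH'.
- by split=> K n; move: (K n); rewrite IH.
Qed.

(** The last branch peels off one [behead] at a time to reach a variable bound further out. *)
Ltac definability := repeat first
  [ progress cbv beta
  | apply: def_const | apply: dterm_const
  | apply: def_all | apply: def_ex | apply: def_and | apply: def_or
  | apply: def_imp | apply: def_if | apply: def_not | apply: def_eq | apply: def_le
  | apply: def_fin_all => ?
  | apply: dterm_head | apply: dterm_tup | apply: dterm_pr
  | apply: dterm_succ | apply: dterm_add | apply: dterm_mul
  | apply: dterm_app
  | lazymatch goal with |- dterm (fun X e => head _ (behead (@?t X e))) =>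
      refine (@dterm_behead (fun X e => head 0 (t X e)) _) end ].

(** Injectivity of [tup] lets one function hold a whole family of tables. *)
Lemma table (V : nat -> nat -> nat -> nat -> nat) :
  exists X : baire, forall c x y z, X (tup c x y z) = V c x y z.
Proof.
have /choice[X HX] : forall n, exists m, forall c x y z, n = tup c x y z -> m = V c x y z.
  move=> n; have [[c [x [y [z E]]]]|H] := pselect (exists c x y z, n = tup c x y z).
    by exists (V c x y z) => c' x' y' z'; rewrite E => /tup_inj[-> -> -> ->].
  by exists 0 => c x y z E; case: H; exists c, x, y, z.
by exists X => c x y z; apply: HX.
Qed.

(** [g] is arithmetical relative to the set variable [X] of an arithmetical
    sentence all of whose solutions carry [g] in column [0]; the other columns
    are free for auxiliary tables.  Such a [g] is hyperarithmetical because
    "some solution satisfies ..." and "every solution satisfies ..." agree. *)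
Definition implicit (g : nat -> nat -> nat -> nat) : Prop :=
  exists Q : baire -> Prop, [/\ definable (fun X _ => Q X), exists X, Q X &
    forall X, Q X -> forall x y z, X (tup 0 x y z) = g x y z].

Lemma hyperarithmetical_implicit q : implicit (fun x _ _ => q x) -> hyperarithmetical q.
Proof.
move=> [Q [dQ [X0 QX0] Qq]].
have S (b : bool) : Sigma11 (fun n m => if b then q n = m else ~ (q n = m)).
  have : definable (fun X e => Q X /\ if b then X (tup 0 (head 0 e) 0 0) = head 0 (behead e)
      else ~ (X (tup 0 (head 0 e) 0 0) = head 0 (behead e))).
    by apply: def_and => //; case: b; definability.
  move=> [phi H]; exists phi => n m; split.
    by exists X0; apply/H; split=> //; destruct b; rewrite /= (Qq _ QX0).
  by move=> [X /H[QX]]; destruct b; rewrite /= (Qq _ QX).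
split; [exact: (S true)|exact: (S false)].
Qed.

(** Closure under arithmetical definitions: [Q] constrains a working table whose first columns hold
    the functions [gs], whose column [size gs] holds [g], and whose later columns are auxiliary. [V]
    witnesses that [Q] can be satisfied. *)
Lemma implicit_rel (gs : seq (nat -> nat -> nat -> nat)) g (Q : baire -> Prop) V :
  (forall i : 'I_(size gs), implicit (nth g gs i)) ->
  definable (fun X _ => Q X) ->
  (forall i, i < size gs -> V i = nth g gs i) ->
  (forall X, (forall c x y z, X (tup c x y z) = V c x y z) -> Q X) ->
  (forall X, (forall i, i < size gs -> forall x y z, X (tup i x y z) = nth g gs i x y z) ->
    Q X -> forall x y z, X (tup (size gs) x y z) = g x y z) ->
  implicit g.
Proof.
move=> /choice[P HP] dQ HV QV Qg.
(* Column [1] is the working table, and column [i.+2] is a solution for [nth g gs i], whose result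
   is copied into the table. Column [0] exports [g]. *)
pose S X := (forall x y z, X (tup 0 x y z) = X (pr 1 (tup (size gs) x y z))) /\
  (Q (column X 1) /\ forall i : 'I_(size gs), P i (column X i.+2) /\
    forall x y z, X (pr 1 (tup i x y z)) = X (pr i.+2 (tup 0 x y z))).
exists S; split.
- apply: def_and; first by definability.
  apply: def_and; first exact: (def_column 1 dQ).
  apply: def_fin_all => i; case: (HP i) => dP _ _.
  by apply: def_and; [apply: (def_column i.+2 dP)|definability].
- have /choice[W HW] : forall i, exists X, P i X by move=> i; case: (HP i).
  have [XV HXV] := table V.
  have /choice[X HX] : forall n, exists m, forall c k, n = pr c k ->
      m = if c is c'.+1 then if c' is i.+1 then
        if insub i is Some j then W j k else 0 else XV k else
        if pselect (exists x y z, k = pr x (pr y z)) is left _ then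
          XV (pr (size gs) k) else 0.
    move=> n; have [[c [k ->]]|H] := pselect (exists c k, n = pr c k).
      by eexists=> c' k' /pr_inj[<- <-].
    by exists 0 => c k E; case: H; exists c, k.
  have H1 : column X 1 = XV by apply/funext=> k; rewrite /column (HX _ _ _ erefl).
  have H2 (i : 'I_(size gs)) : column X i.+2 = W i.
    by apply/funext=> k; rewrite /column (HX _ _ _ erefl) valK.
  have E1 k : X (pr 1 k) = XV k by rewrite -H1.
  have E2 (i : 'I_(size gs)) k : X (pr i.+2 k) = W i k by rewrite -H2.
  exists X; split; [|split].
  + move=> x y z; rewrite E1 /tup (HX _ _ _ erefl).
    by case: pselect => // -[]; exists x, y, z.
  + by rewrite H1; apply: QV.
  + move=> i; rewrite H2; split=> // x y z; rewrite E1 E2 HXV HV //.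
    by case: (HP i) => _ _ ->.
- move=> X [H0 [HQ Hi]] x y z; rewrite H0.
  apply: (Qg (column X 1)) => // i li x' y' z'.
  have [Pi /= E] := Hi (Ordinal li); rewrite /column E.
  by case: (HP (Ordinal li)) => _ _ /(_ _ Pi) /= <-.
Qed.

(** Explicit definitions: the sentence demands [Q] of every entry of the new column, and [Q] admits
    just one value. *)
Lemma implicit_graph (gs : seq (nat -> nat -> nat -> nat)) g
    (Q : baire -> nat -> nat -> nat -> nat -> Prop) :
  (forall i : 'I_(size gs), implicit (nth g gs i)) ->
  definable (fun X _ => forall x y z v, X (tup (size gs) x y z) = v -> Q X x y z v) ->
  (forall X, (forall i, i < size gs -> forall x y z, X (tup i x y z) = nth g gs i x y z) ->
    forall x y z v, Q X x y z v <-> g x y z = v) ->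
  implicit g.
Proof.
move=> Hgs dQ HQ; pose V i := nth g gs i.
apply: (implicit_rel (V := V) Hgs dQ) => [//|X HX|X HX HQX].
  move=> x y z v E; apply/HQ; last by rewrite -E HX /V nth_default.
  by move=> i li x' y' z'; rewrite HX.
by move=> x y z; apply/esym/(HQ _ HX)/HQX.
Qed.

(** * Outputs of limit machines are implicitly defined *)

Definition block (n : nat) : seq bool := rcons (nseq n true) false.

(** The tape position at which block [k] begins. *)
Definition offset (p : baire) (k : nat) : nat := \sum_(l < k) (p l).+1.

Definition prefix_code (p : baire) (k : nat) : seq bool :=
  flatten [seq block (p l) | l <- iota 0 k].

Lemma offsetS p k : offset p k.+1 = offset p k + (p k).+1.
Proof. by rewrite /offset big_ord_recr. Qed.

Lemma offset_ge p k : k <= offset p k.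
Proof. by elim: k => // k IH; rewrite offsetS; lia. Qed.

Lemma prefix_codeS p k : prefix_code p k.+1 = prefix_code p k ++ block (p k).
Proof. by rewrite /prefix_code -addn1 iotaD map_cat flatten_cat /= cats0. Qed.

Lemma size_prefix_code p k : size (prefix_code p k) = offset p k.
Proof.
elim: k => [|k IH]; first by rewrite /offset big_ord0.
by rewrite prefix_codeS size_cat IH offsetS size_rcons size_nseq.
Qed.

Lemma encode_prefix p k i : i < offset p k -> encode p i = nth false (prefix_code p k) i.
Proof.
(* Longer prefixes extend shorter ones, so any prefix covering position [i] shows the same
   letter. *)
have mono a b : a <= b -> i < offset p a ->
    nth false (prefix_code p b) i = nth false (prefix_code p a) i.
  move=> ab; rewrite -(subnKC ab); elim: (b - a) => [|d IH] lt_i; first by rewrite addn0.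
  rewrite addnS prefix_codeS nth_cat size_prefix_code ifT ?IH //.
  by apply: leq_trans lt_i _; elim: d {IH} => [|d IH]; rewrite ?addn0 // addnS offsetS; lia.
move=> lt_i; rewrite -[encode p i]/(nth false (prefix_code p i.+1) i).
have [ki|ki] := leqP k i.+1; first exact: mono.
by apply/esym/mono; [lia|apply: offset_ge].
Qed.

Lemma encode_offset p k x : x <= p k -> encode p (offset p k + x) = (x < p k).
Proof.
move=> xk; rewrite (@encode_prefix _ k.+1) ?offsetS; last by lia.
rewrite prefix_codeS nth_cat size_prefix_code ifF; last by lia.
have -> : offset p k + x - offset p k = x by lia.
by rewrite nth_rcons size_nseq nth_nseq; case: ltngtP xk.
Qed.

(** The tape is periodic, so its zeros are found by divisibility; this makes the input letter of a
    run on a constant sequence arithmetical. *)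
Lemma encode_const n i : encode (fun=> n) i <-> ~ exists k, i.+1 = k * n.+1.
Proof.
have offk k : offset (fun=> n) k = k * n.+1 by rewrite /offset sum_nat_const card_ord.
have E := divn_eq i n.+1; have L : i %% n.+1 <= n by rewrite -ltnS ltn_pmod.
have := @encode_offset (fun=> n) (i %/ n.+1) _ L.
rewrite offk -E => ->; move: (i %/ n.+1) (i %% n.+1) E L => q m -> L.
split=> [lt [k Ek]|H].
- have : m.+1 = (k - q) * n.+1 by rewrite mulnBl -Ek; lia.
  by case: (k - q) => // k'; rewrite mulSn; lia.
- rewrite ltn_neqAle L andbT; apply/eqP => En; apply: H.
  by exists q.+1; rewrite En mulSn; lia.
Qed.

Section RunTables.
Variables (M : machine) (r : nat -> baire).
Hypothesis Mr : forall n, produces M (fun=> n) (r n).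

Let code (T : finType) (x : T) : nat := enum_rank x.

Let code_inj (T : finType) (x y : T) : code x = code y -> x = y.
Proof. by move/val_inj/enum_rank_inj. Qed.

Let conf n t := run M (fun=> n) t.

Local Arguments run : simpl never.

(** Columns: [0] and [1] hold the output and its block offsets, [2] to [5] the
    state, input head, output head and output cells, and [6 + 2j], [7 + 2j] the
    head and the cells of work tape [j].  The arguments are the input [n] (for
    the constant sequence [n]), the time, and the cell. *)
Definition run_table (c x y z : nat) : nat :=
  match c with
  | 0 => r x y
  | 1 => offset (r x) y
  | 2 => code (cstate (conf x y))
  | 3 => cin (conf x y)
  | 4 => position (cout (conf x y))
  | 5 => code (cell (cout (conf x y)) z)
  | c'.+4.+2 => if insub c'./2 is Some j then
      if odd c' then code (cell (cwork (conf x y) j) z) else position (cwork (conf x y) j)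
      else 0
  end.

Let wpos (j : 'I_(ntapes M)) := j.*2.+4.+2.
Let wcell (j : 'I_(ntapes M)) := j.*2.+4.+3.

Let wposE j x y z : run_table (wpos j) x y z = position (cwork (conf x y) j).
Proof. by rewrite /= doubleK valK odd_double. Qed.

Let wcellE j x y z : run_table (wcell j) x y z = code (cell (cwork (conf x y) j) z).
Proof. by rewrite /= uphalf_double valK odd_double. Qed.

(** A relational form of [shift] that avoids the predecessor, which is no term of the language. *)
Definition moves (m : move) (h h' : nat) : Prop :=
  match m with
  | Left => (h = 0 /\ h' = 0) \/ h = h'.+1
  | Stay => h' = h
  | Right => h' = h.+1
  end.

Lemma movesP m h h' : moves m h h' <-> h' = shift m h.
Proof. by case: m => //=; lia. Qed.

Lemma def_moves m f g : dterm f -> dterm g ->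
  definable (fun X e => moves m (f X e) (g X e)).
Proof. by case: m => df dg; definability. Qed.

Definition initial_row (V : nat -> nat -> nat -> nat -> nat) : Prop :=
  forall n, V 2 n 0 0 = code (start M) /\ V 3 n 0 0 = 0 /\ V 4 n 0 0 = 0 /\
    (forall i, V 5 n 0 i = code (None : option bool)) /\
    forall j, V (wpos j) n 0 0 = 0 /\ forall i, V (wcell j) n 0 i = code (blank M).

(** Quantifying over all possible scanned data leaves finitely many fixed instances of [trans]. The
    premise on [a] expresses the input letter through [encode_const]. *)
Definition step_row (V : nat -> nat -> nat -> nat -> nat) : Prop :=
  forall n t (s : state M) (a : bool) (w : {ffun 'I_(ntapes M) -> letter M}) (c : option bool),
    V 2 n t 0 = code s ->
    (if a then ~ exists k, (V 3 n t 0).+1 = k * n.+1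
     else exists k, (V 3 n t 0).+1 = k * n.+1) ->
    V 5 n t (V 4 n t 0) = code c ->
    (forall j, V (wcell j) n t (V (wpos j) n t 0) = code (w j)) ->
    let u := trans s a w c in
    V 2 n t.+1 0 = code u.1.1.1 /\ moves u.1.1.2 (V 3 n t 0) (V 3 n t.+1 0) /\
    moves u.2.2 (V 4 n t 0) (V 4 n t.+1 0) /\
    (forall i, (i = V 4 n t 0 -> V 5 n t.+1 i = code u.2.1) /\
               (~ (i = V 4 n t 0) -> V 5 n t.+1 i = V 5 n t i)) /\
    forall j, moves (u.1.2 j).2 (V (wpos j) n t 0) (V (wpos j) n t.+1 0) /\
      forall i, (i = V (wpos j) n t 0 -> V (wcell j) n t.+1 i = code (u.1.2 j).1) /\
                (~ (i = V (wpos j) n t 0) -> V (wcell j) n t.+1 i = V (wcell j) n t i).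

(** A limit is a cell that stays fixed from some time on. The final letters [true] and the closing
    [false] pin down the length of block [k]. *)
Definition output_row (V : nat -> nat -> nat -> nat -> nat) : Prop :=
  forall n, V 1 n 0 0 = 0 /\ forall k,
    V 1 n k.+1 0 = V 1 n k 0 + (V 0 n k 0).+1 /\
    (exists t0, forall t, V 5 n (t0 + t) (V 1 n k 0 + V 0 n k 0) = code (Some false)) /\
    (forall x, x.+1 <= V 0 n k 0 ->
      exists t0, forall t, V 5 n (t0 + t) (V 1 n k 0 + x) = code (Some true)) /\
    forall z, V 0 n k z = V 0 n k 0.

Definition represents (V : nat -> nat -> nat -> nat -> nat) : Prop :=
  forall n t, V 2 n t 0 = code (cstate (conf n t)) /\ V 3 n t 0 = cin (conf n t) /\
    V 4 n t 0 = position (cout (conf n t)) /\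
    (forall i, V 5 n t i = code (cell (cout (conf n t)) i)) /\
    forall j, V (wpos j) n t 0 = position (cwork (conf n t) j) /\
      forall i, V (wcell j) n t i = code (cell (cwork (conf n t) j) i).

Lemma represents_step V : represents V -> step_row V.
Proof.
move=> HV n t s a w c.
have [-> [-> [-> [E5 Ew]]]] := HV n t; have [-> [-> [-> [E5' Ew']]]] := HV n t.+1.
move=> /code_inj <- Ha; rewrite E5 => /code_inj <- Hw.
have -> : a = encode (fun=> n) (cin (conf n t)).
  have := encode_const n (cin (conf n t)).
  by case: a Ha => Ha H; apply/esym/idP; [apply/H|move/H].
have -> : w = [ffun j => scan (cwork (conf n t) j)].
  apply/ffunP => j; rewrite ffunE; apply: code_inj.
  by rewrite -Hw; case: (Ew j) => -> ->.
rewrite -[cell _ _]/(scan (cout (conf n t))).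
have : conf n t.+1 = step (fun=> n) (conf n t) by [].
rewrite /step; case: (trans _ _ _ _) => [[[s' mi] w'] o] Econf /=.
rewrite Econf /=; split=> //; split; first exact/movesP.
split; first exact/movesP; split=> [i|j].
  by rewrite E5' E5 Econf /=; case: eqP.
have [-> Ec] := Ew j; have [-> Ec'] := Ew' j; rewrite Econf /=.
split=> [|i]; first exact/movesP.
by rewrite Ec Ec' Econf /=; case: eqP.
Qed.

(** Induction on time: the data scanned at time [t] leave no freedom for the next row. *)
Lemma rows_represent V : initial_row V -> step_row V -> represents V.
Proof.
move=> HI HS n; elim=> [|t [E2 [E3 [E4 [E5 Ew]]]]]; first exact: HI.
have := HS n t _ (encode (fun=> n) (cin (conf n t)))
  [ffun j => scan (cwork (conf n t) j)] (scan (cout (conf n t))) E2.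
rewrite E3 E4; case.
- have := encode_const n (cin (conf n t)); case: encode => H; first exact/H.
  by apply: contrapT => /H.
- exact: E5.
- by move=> j; rewrite ffunE; case: (Ew j) => -> ->.
have : conf n t.+1 = step (fun=> n) (conf n t) by [].
rewrite /step; case: (trans _ _ _ _) => [[[s' mi] w'] o] Econf /=.
move=> -> [/movesP-> [/movesP-> [F5 Fw]]]; rewrite Econf /=.
do 4!split => //.
  by move=> i; have [A B] := F5 i; case: eqP => [/A//|/B ->].
move=> j; have [A B] := Fw j; have [C D] := Ew j; split; first by rewrite -C; apply/movesP.
move=> i; have [A' B'] := B i; rewrite -C; case: eqP => [/A'//|/B' ->//].
Qed.

(** Each output cell converges, so its limit and the correct letter can be compared at a time late
    enough for both. *)
Lemma represents_output V n i b : represents V ->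
  (exists t0, forall t, V 5 n (t0 + t) i = code (Some b)) <-> encode (r n) i = b.
Proof.
move=> HV; have [t1 Ht1] := Mr n i.
have E t : V 5 n t i = code (cell (cout (conf n t)) i) by case: (HV n t) => _ [_ [_ [-> _]]].
split=> [[t0 /(_ t1)]|<-]; last by exists t1 => t; rewrite E Ht1 // leq_addr.
by rewrite E Ht1 ?leq_addl // => /code_inj[].
Qed.

Lemma implicit_produced : implicit (fun n k _ => r n k).
Proof.
pose V (X : baire) c x y z := X (tup c x y z).
apply: (@implicit_rel [::] _
  (fun X => initial_row (V X) /\ step_row (V X) /\ output_row (V X)) run_table) => //.
- by case.
- apply: def_and; first by rewrite /initial_row /V; definability.
  apply: def_and; last by rewrite /output_row /V; definability.
  by rewrite /step_row /V; definability; apply: def_moves; definability.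
- move=> X HX; have EV : V X = run_table by do 4!apply/funext=> ?; apply: HX.
  rewrite EV; have HR : represents run_table.
    by move=> n t; do 4!split=> //.
  split; first by move=> n; exact: (HR n 0).
  split; first exact: represents_step.
  move=> n; split; first by rewrite /= /offset big_ord0.
  move=> k; split; first by rewrite /= offsetS.
  split; first by apply/represents_output => //=; rewrite encode_offset // ltnn.
  split=> // x ltx; apply/represents_output => //=.
  by rewrite encode_offset //; apply: ltnW.
- move=> X _ [HI [HS HO]]; have HR := rows_represent HI HS.
  move=> n k z; have [H0 HO'] := HO n.
  have E k' : V X 1 n k' 0 = offset (r n) k' -> V X 0 n k' 0 = r n k'.
    have [_ [/(represents_output _ _ _ HR) Hf [Ht _]]] := HO' k'; move=> E1.
    move: Hf Ht; rewrite E1; set v := V X 0 n k' 0 => Hf Ht.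
    (* Too small a value would put the closing [false] inside the block; too large a value would put
       [true] on the closing cell. *)
    have [lt|gt|//] := ltngtP v (r n k').
      by move: Hf; rewrite encode_offset ?lt // ltnW.
    by move/(represents_output _ _ _ HR): (Ht _ gt); rewrite encode_offset // ltnn.
  have E1 : V X 1 n k 0 = offset (r n) k.
    elim: k => [|k IH]; first by rewrite H0 /offset big_ord0.
    by have [-> _] := HO' k; rewrite IH offsetS (E _ IH).
  have [_ [_ [_ Ez]]] := HO' k.
  by rewrite -[LHS]/(V X 0 n k z) Ez (E _ E1).
Qed.

End RunTables.

(** * A machine interpreting a transition table *)

(** The machine simulates a transducer with infinitely many states on the bits
    of its own input tape [z].  The even blocks of [z] are the transition table:
    in the state with address [A], the bit [b] leads to the entry [v] in block
    [2(A + b)], which holds the next address [v / 3] and the output [v mod 3].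
    The first work tape moves in lockstep with the input head, with a mark on
    the bottom cell and on every cell already consumed, so that the next fresh bit can
    be found again after a lookup; the second is a counter whose head position
    is the address. *)
Inductive phase :=
| Launch | Fetch | Back of option bool | Look of bool | SkipOwn of bool | SkipOther of bool
| Read of 'I_3.

Definition phase_code (s : phase) : bool + option bool + (bool + bool + bool + 'I_3) :=
  match s with
  | Launch => inl (inl true)
  | Fetch => inl (inl false)
  | Back o => inl (inr o)
  | Look b => inr (inl (inl (inl b)))
  | SkipOwn b => inr (inl (inl (inr b)))
  | SkipOther b => inr (inl (inr b))
  | Read i => inr (inr i)
  end.

Definition phase_decode x : phase :=
  match x with
  | inl (inl b) => if b then Launch else Fetch
  | inl (inr o) => Back o
  | inr (inl (inl (inl b))) => Look b
  | inr (inl (inl (inr b))) => SkipOwn b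
  | inr (inl (inr b)) => SkipOther b
  | inr (inr i) => Read i
  end.

Lemma phase_codeK : cancel phase_code phase_decode.
Proof. by case. Qed.

HB.instance Definition _ := Finite.copy phase (can_type phase_codeK).

Definition emitted (i : nat) : seq bool :=
  match i with 0 => [::] | 1 => [:: false] | _ => [:: true] end.

Definition bottom : option bool := Some true.
Definition visited : option bool := Some false.

(** [Look] counts the address down, and each unit skips a table block ([SkipOwn]) and the data block
    after it ([SkipOther]); a bit [true] costs one more such pair. [Read] divides the block length
    by three, with the remainder in the state and the quotient on the counter. [Back] rewinds, and
    [Fetch] looks for the first unmarked cell. *)
Definition action (s : phase) (a : bool) (x y c : option bool) :
    phase * move * (option bool * move) * (option bool * move) * (option bool * move) :=
  let keep := (c, Stay) in
  match s with
  | Launch => (Look a, Stay, (bottom, Stay), (bottom, Stay), keep)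
  | Fetch => if x is None then (Back (Some a), Stay, (visited, Stay), (y, Stay), keep)
      else (Fetch, Right, (x, Right), (y, Stay), keep)
  | Back o => if x == bottom then
      (if o is Some b then Look b else Fetch, Stay, (x, Stay), (y, Stay), keep)
      else (Back o, Left, (x, Left), (y, Stay), keep)
  | Look b => if y == bottom then
      (if b then SkipOwn false else Read ord0, Stay, (x, Stay), (y, Stay), keep)
      else (SkipOwn b, Stay, (x, Stay), (y, Left), keep)
  | SkipOwn b => (if a then SkipOwn b else SkipOther b, Right, (x, Right), (y, Stay), keep)
  | SkipOther b => (if a then SkipOther b else Look b, Right, (x, Right), (y, Stay), keep)
  | Read i => if a then
      (Read (inord (i.+1 %% 3)), Right, (x, Right), (y, if i == 2 :> nat then Right else Stay), keep)
      else (Back None, Stay, (x, Stay), (y, Stay),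
            if emitted i is b :: _ then (Some b, Right) else keep)
  end.

Definition second : 'I_2 := lift ord0 ord0.

Definition transducer_machine : machine := @Machine phase Launch (option bool) None 2
  (fun s a w c => let: (s', mi, u, v, o) := action s a (w ord0) (w second) c in
    (s', mi, [ffun j => if j == ord0 then u else v], o)).

Lemma transducer_one_way : one_way transducer_machine.
Proof.
rewrite /one_way; move=> s a w c; rewrite /trans /=.
case: s => [||o|b|b|b|i] /=; repeat case: ifP => //= _; try by left.
- by case: (w ord0); left.
- by rewrite /emitted; case: (val i) => [|[|n]]; [left|right; exists false|right; exists true].
Qed.

(** * Configurations and runs of the interpreter *)

Definition shadow (m : nat) : nat -> option bool :=
  fun i => if i == 0 then bottom else if i <= m then visited else None.

Definition counter : nat -> option bool := fun i => if i == 0 then bottom else None.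

Definition written (o : seq bool) : nat -> option bool :=
  fun i => if i < size o then Some (nth false o i) else None.

Definition conf (s : phase) (h a m : nat) (o : seq bool) : config transducer_machine :=
  @Config transducer_machine s h
    (fun j => if j == ord0 then Tape (shadow m) h else Tape counter a)
    (Tape (written o) (size o)).

Lemma write_same A (f : nat -> A) h m : write (Tape f h) (f h, m) = Tape f (shift m h).
Proof.
by rewrite /write /=; congr Tape; apply/funext => i; case: eqP => [->|].
Qed.

Lemma stepE z s h a m o :
  step z (conf s h a m o) =
  let: (s', mi, u, v, w) := action s (encode z h) (shadow m h) (counter a) None in
  @Config transducer_machine s' (shift mi h)
    (fun j => if j == ord0 then write (Tape (shadow m) h) u else write (Tape counter a) v)
    (write (Tape (written o) (size o)) w).
Proof.
rewrite /step /= !ffunE /= /scan /= /written ltnn.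
case: (action _ _ _ _ _) => [[[[s' mi] u] v] w].
by congr Config; apply/funext=> j; rewrite ffunE; case: ifP.
Qed.

Lemma write_blank o m : write (Tape (written o) (size o)) (None, m) =
  Tape (written o) (shift m (size o)).
Proof. by rewrite -write_same {3}/written ltnn. Qed.

Lemma write_letter o b :
  write (Tape (written o) (size o)) (Some b, Right) = Tape (written (rcons o b)) (size (rcons o b)).
Proof.
rewrite /write /= size_rcons; congr Tape; apply/funext=> i.
by rewrite /written size_rcons nth_rcons ltnS; case: ltngtP.
Qed.

Definition reach (z : baire) (c c' : config transducer_machine) : Prop :=
  exists n, iter n (step z) c = c'.

Lemma reach_refl z c : reach z c c. Proof. by exists 0. Qed.

Lemma reach_trans z c c' c'' : reach z c c' -> reach z c' c'' -> reach z c c''.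
Proof. by move=> [n <-] [k <-]; exists (k + n); rewrite iterD. Qed.

Lemma reach_step z c c' c'' : step z c = c' -> reach z c' c'' -> reach z c c''.
Proof. by move=> <-; apply: reach_trans; exists 1. Qed.

Section Phases.
Variable z : baire.

Lemma step_back_bottom r a m o :
  step z (conf (Back r) 0 a m o) = conf (if r is Some b then Look b else Fetch) 0 a m o.
Proof. by rewrite stepE /= !write_same write_blank. Qed.

Lemma step_back r h a m o : step z (conf (Back r) h.+1 a m o) = conf (Back r) h a m o.
Proof.
rewrite stepE /= /shadow /= ifF; last by case: ifP.
by rewrite -/(shadow m h.+1) -/(shadow m) !write_same write_blank.
Qed.

Lemma reach_back r h a m o :
  reach z (conf (Back r) h a m o) (conf (if r is Some b then Look b else Fetch) 0 a m o).
Proof.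
elim: h => [|h IH]; first by exists 1; rewrite /= step_back_bottom.
exact: reach_step (step_back _ _ _ _ _) IH.
Qed.

Lemma step_fetch h a m o : h <= m -> step z (conf Fetch h a m o) = conf Fetch h.+1 a m o.
Proof.
move=> hm; rewrite stepE /=; case E: (shadow m h) => [x|]; first by rewrite -E !write_same write_blank.
by move: E; rewrite /shadow hm; case: eqP.
Qed.

Lemma step_fetch_fresh a m o :
  step z (conf Fetch m.+1 a m o) = conf (Back (Some (encode z m.+1))) m.+1 a m.+1 o.
Proof.
rewrite stepE /= /shadow /= ltnn -/(shadow m) !write_same write_blank /conf; congr Config.
apply/funext => j; case: ifP => // _; rewrite /write /=; congr Tape; apply/funext => i.
by rewrite /shadow; case: i => //= i; rewrite eqSS ltnS; case: ltngtP.
Qed.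

(** Exactly the cells up to [m] are marked, so the first unmarked one lies over the fresh bit
    [m.+1]. *)
Lemma reach_fetch a m o :
  reach z (conf Fetch 0 a m o) (conf (Look (encode z m.+1)) 0 a m.+1 o).
Proof.
have H h : h <= m.+1 -> reach z (conf Fetch 0 a m o) (conf Fetch h a m o).
  elim: h => [_|h IH hm]; first exact: reach_refl.
  apply: reach_trans (IH _) _; first exact: ltnW.
  by apply: reach_step (step_fetch _ _ _) (reach_refl _ _).
apply: reach_trans (H _ (leqnn _)) _.
by apply: reach_step (step_fetch_fresh _ _ _) _; apply: reach_back.
Qed.

Lemma step_skip_own b h a m o : step z (conf (SkipOwn b) h a m o) =
  conf (if encode z h then SkipOwn b else SkipOther b) h.+1 a m o.
Proof. by rewrite stepE /= !write_same write_blank. Qed.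

Lemma step_skip_other b h a m o : step z (conf (SkipOther b) h a m o) =
  conf (if encode z h then SkipOther b else Look b) h.+1 a m o.
Proof. by rewrite stepE /= !write_same write_blank. Qed.

Lemma reach_block s s' k a m o :
  (forall h, step z (conf s h a m o) = conf (if encode z h then s else s') h.+1 a m o) ->
  reach z (conf s (offset z k) a m o) (conf s' (offset z k.+1) a m o).
Proof.
move=> H; have R x : x <= z k ->
    reach z (conf s (offset z k) a m o) (conf s (offset z k + x) a m o).
  elim: x => [|x IH] lx; first by rewrite addn0; exact: reach_refl.
  apply: reach_trans (IH (ltnW lx)) _.
  by apply: reach_step (H _) _; rewrite encode_offset ?lx ?addnS; [exact: reach_refl|exact: ltnW].
apply: reach_trans (R _ (leqnn _)) _.
apply: reach_step (H _) _; rewrite encode_offset // ltnn offsetS addnS.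
exact: reach_refl.
Qed.

Lemma reach_skip b k a m o :
  reach z (conf (SkipOwn b) (offset z k) a m o) (conf (Look b) (offset z k.+2) a m o).
Proof.
apply: (@reach_trans _ _ (conf (SkipOther b) (offset z k.+1) a m o)); apply: reach_block => h.
  exact: step_skip_own.
exact: step_skip_other.
Qed.

Lemma step_look b h a m o : step z (conf (Look b) h a.+1 m o) = conf (SkipOwn b) h a m o.
Proof. by rewrite stepE /= !write_same write_blank. Qed.

Lemma step_look_bottom b h m o :
  step z (conf (Look b) h 0 m o) = conf (if b then SkipOwn false else Read ord0) h 0 m o.
Proof. by rewrite stepE /= !write_same write_blank. Qed.

Lemma reach_look b k a m o : reach z (conf (Look b) (offset z k) a m o)
  (conf (Read ord0) (offset z (k + (a + b).*2)) 0 m o).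
Proof.
elim: a k => [|a IH] k.
  apply: reach_step (step_look_bottom _ _ _ _) _; case: b => /=; last first.
    by rewrite (_ : k + _ = k); [exact: reach_refl|exact: addn0].
  apply: reach_trans (reach_skip _ _ _ _ _) _.
  by apply: reach_step (step_look_bottom _ _ _ _) _; rewrite (_ : k + _ = k.+2); [exact: reach_refl|exact: addn2].
apply: reach_step (step_look _ _ _ _ _) _; apply: reach_trans (reach_skip _ _ _ _ _) _.
by have := IH k.+2; rewrite addSn doubleS !addnS !addSn.
Qed.

Lemma step_read (i : 'I_3) h a m o : encode z h ->
  step z (conf (Read i) h a m o) = conf (Read (inord (i.+1 %% 3))) h.+1 (a + (i == 2 :> nat)) m o.
Proof.
move=> e; rewrite stepE /= e !write_same write_blank.
by case: (_ == 2); rewrite /= ?addn1 ?addn0.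
Qed.

Lemma step_read_end (i : 'I_3) h a m o : ~~ encode z h ->
  step z (conf (Read i) h a m o) = conf (Back None) h a m (o ++ emitted i).
Proof.
move=> /negbTE e; rewrite stepE /= e !write_same.
case E: (emitted i) => [|b s]; first by rewrite cats0 write_blank.
have -> : s = [::] by move: E; rewrite /emitted; case: (nat_of_ord i) => [|[|?]] //= [_ <-].
by rewrite cats1 write_letter.
Qed.

Lemma reach_read k m o : reach z (conf (Read ord0) (offset z k) 0 m o)
  (conf Fetch 0 (z k %/ 3) m (o ++ emitted (z k %% 3))).
Proof.
have R x : x <= z k -> reach z (conf (Read ord0) (offset z k) 0 m o)
    (conf (Read (inord (x %% 3))) (offset z k + x) (x %/ 3) m o).
  elim: x => [|x IH] lx.
    rewrite addn0 (_ : inord _ = ord0); first exact: reach_refl.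
    by apply: val_inj; rewrite /= inordK.
  apply: reach_trans (IH (ltnW lx)) _.
  apply: reach_step (step_read _ _ _ _ _) _.
    by rewrite encode_offset ?lx // ltnW.
  rewrite inordK ?ltn_pmod // addnS.
  have -> : (x %% 3).+1 %% 3 = x.+1 %% 3 by lia.
  have -> : x %/ 3 + (x %% 3 == 2) = x.+1 %/ 3 by case: eqP; lia.
  exact: reach_refl.
apply: reach_trans (R _ (leqnn _)) _.
refine (reach_step (step_read_end _ _ _ _ _) _).
  by rewrite encode_offset // ltnn.
by rewrite inordK ?ltn_pmod //; exact: reach_back.
Qed.

Fixpoint address (m : nat) : nat :=
  if m is m'.+1 then z (address m' + encode z m').*2 %/ 3 else 0.

Fixpoint output (m : nat) : seq bool :=
  if m is m'.+1 then output m' ++ emitted (z (address m' + encode z m').*2 %% 3) else [::].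

Lemma reach_cycle m : reach z (init transducer_machine)
  (conf (Look (encode z m)) 0 (address m) m (output m)).
Proof.
elim: m => [|m IH].
  exists 1; rewrite /= /step /= /conf; congr Config.
  apply/funext => j; rewrite ffunE /write /=; case: ifP => _; congr Tape; apply/funext => -[|i] //=.
  by rewrite /write /scan /=; congr Tape; apply/funext => i; case: eqP.
apply: reach_trans IH _.
have O0 : offset z 0 = 0 by rewrite /offset big_ord0.
rewrite -{1}O0; apply: reach_trans (reach_look _ _ _ _ _) _.
by apply: reach_trans (reach_read _ _ _) _; apply: reach_fetch.
Qed.

(** Cells behind a one-way head are never changed, so it suffices that each letter is printed at
    some moment. *)
Lemma transducer_produces r :
  (forall i, exists m, i < size (output m) /\ nth false (output m) i = encode r i) ->
  produces transducer_machine z r.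
Proof.
move=> H i; have [m [lt_i Ei]] := H i; have [t0 Et0] := reach_cycle m.
exists t0 => t /subnKC <-; rewrite addnC /run iterD Et0.
set c := conf _ _ _ _ _; suff /(_ (t - t0))[_ ->] : forall d,
    i < position (cout (iter d (step z) c)) /\
    cell (cout (iter d (step z) c)) i = cell (cout c) i.
  by rewrite /c /= /written lt_i Ei.
elim=> [//|d]; rewrite iterS; set c' := iter d (step z) c => -[lt_i' <-].
have := transducer_one_way (cstate c') (encode z (cin c'))
  [ffun j => scan (cwork c' j)] (scan (cout c')).
rewrite /step; case: (trans _ _ _ _) => [[[s' mi] w] o] /= [->|[b ->]] /=.
  by split=> //; case: eqP lt_i' => // ->; rewrite ltnn.
by split; [exact: ltnW|case: eqP lt_i' => // ->; rewrite ltnn].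
Qed.

End Phases.

(** * The search transducer *)

(** State [(k, c, d, s)]: [c] ones of block [k] have been read, the numbers [s]
    have been selected for output, and the last [d] letters of their code are
    still to be printed.  Block [k] of length [c] selects [v] as the next output
    when [w (size s) k c = v.+1]. *)
Definition next (w : nat -> nat -> nat -> nat) (b : bool) (k c d : nat) (s : seq nat) :
    nat * nat * nat * seq nat :=
  if b then (k, c.+1, d.-1, s)
  else if d is d'.+1 then (k.+1, 0, d', s)
  else if w (size s) k c is v.+1 then (k.+1, 0, v.+1, rcons s v)
  else (k.+1, 0, 0, s).

(** With [d] letters of a unary code left, the next one is the closing [false] if [d = 1] and [true]
    if [d] is larger, in the numbering of [emitted]. *)
Definition act (d : nat) : nat := minn d 2.

(** The entry depends on [s] only through its length, hence the dummy [nseq].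
    The factor [6 = 3 * 2] leaves room for the output letter and makes addresses
    even, so that address plus bit determines both. *)
Definition entry w b k c d (n : nat) : nat :=
  let: (k', c', d', s') := next w b k c d (nseq n 0) in
  tup k' c' (size s') d' * 6 + act d.

Lemma transition_table w : implicit w -> exists q : baire,
  implicit (fun x _ _ => q x) /\
  forall b k c s d, q (tup k c s d + tup k c s d + nat_of_bool b) = entry w b k c d s.
Proof.
move=> Hw.
have inj (b b' : bool) t t' : t + t + b = t' + t' + b' -> b = b' /\ t = t'.
  by case: b b' => [] [] /=; lia.
(* Numbers that are no address plus bit get [0], so that the sentence [Q] below can determine [q]
   everywhere. *)
have /choice[q Hq] : forall N, exists v, (forall b k c s d,
    N = tup k c s d + tup k c s d + nat_of_bool b -> v = entry w b k c d s) /\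
    ((forall b k c s d, ~ (N = tup k c s d + tup k c s d + nat_of_bool b)) -> v = 0).
  move=> N; have [[b [k [c [s [d ->]]]]]|H] :=
      pselect (exists b k c s d, N = tup k c s d + tup k c s d + nat_of_bool b).
    exists (entry w b k c d s); split=> [b' k' c' s' d' /inj[-> /tup_inj[-> -> -> ->]] //|].
    by move=> /(_ b k c s d).
  exists 0; split=> // b k c s d E; by case: H; exists b, k, c, s, d.
have Eq b k c s d : q (tup k c s d + tup k c s d + nat_of_bool b) = entry w b k c d s.
  by have [E _] := Hq (tup k c s d + tup k c s d + nat_of_bool b); apply: E.
exists q; split=> //.
pose V i : nat -> nat -> nat -> nat := if i is 0 then w else fun x _ _ => q x.
(* The entries are listed by bit and by [d = 0], [d = 1] and [d >= 2], which eliminates the minimum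
   and the predecessor. *)
pose Q (X : baire) := (forall N y z, X (tup 1 N y z) = X (tup 1 N 0 0)) /\
  (forall N, (forall k c s d, ~ (N = tup k c s d + tup k c s d) /\
       ~ (N = tup k c s d + tup k c s d + 1)) -> X (tup 1 N 0 0) = 0) /\
  forall k c s,
    X (tup 1 (tup k c s 0 + tup k c s 0 + 1) 0 0) = tup k c.+1 s 0 * 6 /\
    X (tup 1 (tup k c s 1 + tup k c s 1 + 1) 0 0) = tup k c.+1 s 0 * 6 + 1 /\
    (forall d, X (tup 1 (tup k c s d.+2 + tup k c s d.+2 + 1) 0 0) = tup k c.+1 s d.+1 * 6 + 2) /\
    X (tup 1 (tup k c s 1 + tup k c s 1) 0 0) = tup k.+1 0 s 0 * 6 + 1 /\
    (forall d, X (tup 1 (tup k c s d.+2 + tup k c s d.+2) 0 0) = tup k.+1 0 s d.+1 * 6 + 2) /\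
    (X (tup 0 s k c) = 0 -> X (tup 1 (tup k c s 0 + tup k c s 0) 0 0) = tup k.+1 0 s 0 * 6) /\
    (forall v, X (tup 0 s k c) = v.+1 ->
       X (tup 1 (tup k c s 0 + tup k c s 0) 0 0) = tup k.+1 0 s.+1 v.+1 * 6).
apply: (@implicit_rel [:: w] _ Q V) => //.
- by move=> [[|//] /= _].
- by rewrite /Q; definability.
- by move=> [].
- move=> X HX; split; first by move=> *; rewrite !HX.
  split=> [N HN|k c s].
    rewrite HX /=; have [_] := Hq N; apply=> b k c s d.
    by case: (HN k c s d); case: b; rewrite ?addn0.
  have Eq0 d : q (tup k c s d + tup k c s d) = entry w false k c d s.
    by rewrite -(Eq false) addn0.
  have Eq1 d : q (tup k c s d + tup k c s d + 1) = entry w true k c d s := Eq true k c s d.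
  rewrite !HX /= !Eq1 !Eq0 /entry /= !size_nseq addn0; do !split=> //.
  - by move=> d; rewrite HX /= Eq1 /entry /= size_nseq.
  - by move=> d; rewrite HX /= Eq0 /entry /= size_nseq.
  - by move=> ->; rewrite /= size_nseq addn0.
  - by move=> v ->; rewrite /= size_rcons size_nseq addn0.
- move=> X HX [HQ1 [HQ0 HQ]] N y z; rewrite [size _]/= HQ1.
  have [[b [k [c [s [d ->]]]]]|H] :=
      pselect (exists b k c s d, N = tup k c s d + tup k c s d + nat_of_bool b); last first.
    have [_ ->] := Hq N; last by move=> b k c s d E; apply: H; exists b, k, c, s, d.
    apply: HQ0 => k c s d; split=> E; apply: H; last by exists true, k, c, s, d.
    by exists false, k, c, s, d; rewrite addn0.
  rewrite Eq; have [E1 [E2 [E3 [E4 [E5 [E6 E7]]]]]] := HQ k c s.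
  case: b; rewrite ?addn0 /entry /= size_nseq.
    by case: d => [|[|d]]; rewrite ?E1 ?E2 ?E3 ?addn0.
  case: d => [|[|d]]; rewrite ?E4 ?E5 /= ?size_nseq //.
  move: E6 E7; rewrite (HX 0) //=; case: (w s k c) => [|v] E6 E7.
    by rewrite E6 // size_nseq addn0.
  by rewrite (E7 v) // size_rcons size_nseq addn0.
Qed.

(** * Invariants and correctness of the transducer *)

Section Transducer.
Variables (w : nat -> nat -> nat -> nat) (q z : baire).
Hypothesis Hq : forall b k c s d,
  q (tup k c s d + tup k c s d + nat_of_bool b) = entry w b k c d s.
Hypothesis Hz : forall n, z n.*2 = q n.

(** The state with the full list of selected numbers, of which the address keeps only the length. *)
Fixpoint ghost (m : nat) : nat * nat * nat * seq nat :=
  if m is m'.+1 then let: (k, c, d, s) := ghost m' in next w (encode z m') k c d s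
  else (0, 0, 0, [::]).

Definition pending (d : nat) : seq bool := if d is v.+1 then block v else [::].

Lemma ghost_inv m : let: (k, c, d, s) := ghost m in
  [/\ m = offset z k + c, c <= z k, address z m = tup k c (size s) d + tup k c (size s) d,
    output z m ++ pending d = flatten (map block s) &
    forall i, i < size s -> exists k', w i k' (z k') = (nth 0 s i).+1].
Proof.
elim: m => [|m]; first by split; rewrite ?/offset ?big_ord0.
rewrite /=; case: (ghost m) => [[[k c] d] s] [Em lec Ea Eo Es].
rewrite Hz Ea Hq; have Ee : encode z m = (c < z k) by rewrite Em encode_offset.
have Ep : pending d = emitted (act d) ++ pending d.-1 by case: d {Ea Eo} => [|[|d]].
have Eact x : (x * 6 + act d) %% 3 = act d /\ (x * 6 + act d) %/ 3 = x + x.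
  have : act d <= 2 by apply: geq_minr.
  by lia.
have Eout : (output z m ++ emitted (act d)) ++ pending d.-1 = flatten [seq block l | l <- s].
  by rewrite -catA -Ep.
rewrite /entry Ee /next; case: ifP => [ltc|/negbT]; last rewrite -leqNgt => gec.
  by case: (Eact (tup k c.+1 (size (nseq (size s) 0)) d.-1)) => -> ->; rewrite size_nseq;
     split=> //; lia.
have {gec lec} Ec : c = z k by apply/eqP; rewrite eqn_leq lec gec.
have Em' : m.+1 = offset z k.+1 + 0 by rewrite offsetS Em Ec addn0 addnS.
case: d Ea Eo Ep Eact Eout => [|d] Ea Eo Ep Eact Eout; last first.
  by case: (Eact (tup k.+1 0 (size (nseq (size s) 0)) d)) => -> ->; rewrite size_nseq; split.
rewrite size_nseq; case Ew : (w (size s) k c) => [|v].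
  by case: (Eact (tup k.+1 0 (size (nseq (size s) 0)) 0)) => -> ->; rewrite size_nseq; split.
case: (Eact (tup k.+1 0 (size (rcons (nseq (size s) 0) v)) v.+1)) => -> ->.
rewrite !size_rcons size_nseq; split=> //.
  by rewrite map_rcons flatten_rcons -Eout /= !cats0.
move=> i; rewrite ltnS nth_rcons; case: ltngtP => // [lt_i _|-> _]; first exact: Es.
by exists k; rewrite -Ec.
Qed.

Lemma ghost_prefix m m' : m <= m' -> exists s, (ghost m').2 = (ghost m).2 ++ s.
Proof.
move=> /subnKC <-; elim: (m' - m) => [|n [s IH]]; first by exists [::]; rewrite addn0 cats0.
rewrite addnS /=; case: (ghost (m + n)) IH => [[[k c] d] t] /= ->; rewrite /next.
case: ifP => _; first by exists s.
case: d => [|d]; last by exists s.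
by case: (w _ _ _) => [|v]; [exists s|exists (rcons s v); rewrite rcons_cat].
Qed.

(** Every step with letters pending prints one of them, whatever bit is read. *)
Lemma ghost_pending m : exists m', m <= m' /\ (ghost m').1.2 = 0.
Proof.
have [d] := ubnP (ghost m).1.2; elim: d m => // d IH m.
case E: (ghost m).1.2 => [|d'] ltd; first by exists m.
have [|m' [le_m E']] := IH m.+1; last by exists m'; split=> //; apply: ltnW.
move: E; rewrite /=; case: (ghost m) => [[[k c] d''] s] /= ->.
by rewrite /next; case: ifP.
Qed.

(** If nothing were selected after the pending letters are gone, the length [s] would stay fixed,
    and the end of a late block [2l + 3] would force a selection. *)
Lemma ghost_grows m : (forall s, exists k0, forall k, k0 <= k -> w s k.*2.+3 (z k.*2.+3) <> 0) ->
  exists m', [/\ m <= m', size (ghost m).2 < size (ghost m').2 & (ghost m').1.2 = 0].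
Proof.
move=> Hw; have [m1 [le_m E1]] := ghost_pending m; pose s := size (ghost m1).2.
suff [m2 [le_m1 lt_s]] : exists m2, m1 <= m2 /\ s < size (ghost m2).2.
  have [m3 [le_m2 E3]] := ghost_pending m2; exists m3; split=> //.
    exact: leq_trans (leq_trans le_m le_m1) le_m2.
  have [t Et] := ghost_prefix le_m; have [t' Et'] := ghost_prefix le_m2.
  rewrite Et' size_cat; apply: leq_trans (leq_addr _ _); apply: leq_ltn_trans lt_s.
  by rewrite /s Et size_cat leq_addr.
have [k0 Hk0] := Hw s; pose l := maxn k0 m1; pose k := l.*2.+3.
(* The position of the closing zero of block [k], where selection takes place; [k] is large enough
   to put it after [m1]. *)
pose m2 := offset z k + z k.
have le_m12 : m1 <= m2 by have := offset_ge z k; rewrite /m2 /k /l; lia.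
apply: contrapT => H.
have Hs n : m1 <= n -> size (ghost n).2 = s.
  move=> le_n; apply/eqP; rewrite eqn_leq leqNgt; apply/andP; split.
    by apply/negP => lt; apply: H; exists n.
  by have [t ->] := ghost_prefix le_n; rewrite size_cat leq_addr.
have Hd n : m1 <= n -> (ghost n).1.2 = 0.
  move=> /subnKC <-; elim: (n - m1) => [|i]; first by rewrite addn0.
  have := Hs _ (leq_addr i.+1 m1); have := Hs _ (leq_addr i m1); rewrite addnS /=.
  case: (ghost _) => [[[k' c] d] t] /= Et; rewrite /next; case: ifP => /= _ + E; rewrite E //.
  by case: (w _ _ _) => [|v] //=; rewrite size_rcons Et => /eqP; rewrite eqn_leq ltnn.
have := Hs _ (leqW le_m12); have := Hs _ le_m12; have := Hd _ le_m12; rewrite /=.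
have := ghost_inv m2; case: (ghost m2) => [[[k' c] d] t] /= [E lec _ _ _] -> Et.
have lt_off a b x : x <= z a -> a < b -> offset z a + x < offset z b.
  move=> lex; elim: b => // b IH; rewrite ltnS leq_eqVlt => /orP[/eqP <-|/IH].
    by rewrite offsetS; lia.
  by rewrite offsetS; lia.
have Ek : k' = k.
  have [lt|lt|//] := ltngtP k' k.
    by have := lt_off _ _ _ lec lt; rewrite -E /m2; lia.
  by have := lt_off _ _ _ (leqnn (z k)) lt; rewrite -/m2 E; lia.
have Ec : c = z k by move: E; rewrite Ek /m2 => /addnI.
rewrite /next {1}/m2 encode_offset // ltnn Et Ek Ec.
case Ew : (w _ _ _) => [|v] /=; last by rewrite size_rcons Et; lia.
by case: (Hk0 l) => //; rewrite leq_maxl.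
Qed.

Lemma transducer_correct :
  (forall s, exists k0, forall k, k0 <= k -> w s k.*2.+3 (z k.*2.+3) <> 0) ->
  exists r, produces transducer_machine z r /\ forall i, exists k, w i k (z k) = (r i).+1.
Proof.
move=> Hw.
(* At time [M n] more than [n] numbers are selected and completely printed. *)
have /choice[M HM] : forall n, exists m, n < size (ghost m).2 /\ (ghost m).1.2 = 0.
  elim=> [|n [m [lt_n _]]].
    by have [m [_ lt E]] := ghost_grows 0 Hw; exists m; split=> //; apply: leq_ltn_trans lt.
  by have [m' [_ lt E]] := ghost_grows m Hw; exists m'; split=> //; apply: leq_ltn_trans lt.
pose r i := nth 0 (ghost (M i)).2 i.
have Er m i : i < size (ghost m).2 -> nth 0 (ghost m).2 i = r i.
  move=> lt_i; have [lt_i' _] := HM i; rewrite /r.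
  have /orP[/ghost_prefix[t ->]|/ghost_prefix[t ->]] := leq_total m (M i).
    by rewrite nth_cat lt_i.
  by rewrite nth_cat lt_i'.
exists r; split=> [|i]; last first.
  have [lt_i _] := HM i; rewrite -(Er _ _ lt_i).
  by have := ghost_inv (M i); case: (ghost (M i)) lt_i => [[[? ?] ?] s] lt_i [_ _ _ _]; apply.
apply: transducer_produces => i; exists (M i).
have [lt_i Ed] := HM i; have := ghost_inv (M i).
have Es : (ghost (M i)).2 = [seq r l | l <- iota 0 (size (ghost (M i)).2)].
  apply: (@eq_from_nth _ 0) => [|j lt_j]; first by rewrite size_map size_iota.
  by rewrite (nth_map 0) ?size_iota // nth_iota // add0n Er.
have lt_off : i < offset r (size (ghost (M i)).2) by apply: leq_trans (offset_ge _ _).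
case: (ghost (M i)) Ed Es lt_off => [[[? ?] d] s] /= -> Es lt_off [_ _ _ Eo _].
have {Eo} -> : output z (M i) = prefix_code r (size s).
  by rewrite -[LHS]cats0 Eo {1}Es -map_comp.
by rewrite size_prefix_code -encode_prefix.
Qed.

End Transducer.

(** * Distances and names *)

Import Order.TTheory GRing.Theory Num.Theory.

Lemma implicit_seq a : computable_seq a -> implicit (fun _ k _ => a k).
Proof.
move=> [M [_ HM]]; apply: (@implicit_produced M (fun=> a)) => n.
exact: HM.
Qed.

Lemma implicit_exp2 : implicit (fun x _ _ => 2 ^ x).
Proof.
apply: (@implicit_rel [::] _ (fun X => (forall y z, X (tup 0 0 y z) = 1) /\
  forall x y z, X (tup 0 x.+1 y z) = X (tup 0 x y z) + X (tup 0 x y z))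
  (fun _ x _ _ => 2 ^ x)) => //; first by case.
- by definability.
- by move=> X HX; split=> [y z|x y z]; rewrite !HX ?expnS ?mul2n -?addnn.
- by move=> X _ [H0 HS] /=; elim=> [|x IH] y z; rewrite ?H0 // HS !IH expnS mul2n -addnn.
Qed.

(** Doubling removes the binomial coefficient and leaves a polynomial equation. *)
Lemma cantor_pairE i j N :
  cantor_pair i j = N <-> N + N = (i + j).+1 * (i + j) + (j + j).
Proof.
rewrite /cantor_pair; have : 'C((i + j).+1, 2) * 2 = (i + j).+1 * (i + j).
  by elim: (i + j) => // n IH; rewrite binS bin1 mulnDl IH; nia.
by lia.
Qed.

(** * Comparison of computable reals with powers of two *)

Section RealBounds.
Local Open Scope ring_scope.
Variable R : realType.

Lemma exp2V_lt (e : R) : 0 < e -> exists k, 2 ^- k < e.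
Proof.
move=> e0; exists (Num.truncn e^-1).+1.
rewrite invf_plt ?posrE // ?exprn_gt0 //.
apply: lt_trans (truncnS_gt _) _.
by rewrite -natrX ltr_nat ltn_expl.
Qed.

Lemma frac_add_lt (a b K L : R) : 0 < b -> 0 < K -> 0 < L ->
  (a / b + K^-1 < L^-1) = ((a * K + b) * L < b * K).
Proof.
move=> b0 K0 L0; have -> : a / b + K^-1 = (a * K + b) / (b * K).
  by field; rewrite !gt_eqF.
by rewrite ltr_pdivrMr ?mulr_gt0 // [L^-1 * _]mulrC ltr_pdivlMr.
Qed.

(** A strict inequality is already visible at some rational approximation plus its error. Clearing
    denominators, separately for each sign, leaves an inequality between natural numbers. *)
Lemma lt_exp2V_approx (r : R) (s a b : nat -> nat) (l : nat) :
  (forall k, b k <> 0%N /\ `|r - (-1) ^+ s k * ((a k)%:R / (b k)%:R)| <= 2 ^- k) ->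
  r < 2 ^- l <-> exists k,
    (exists u, s k = u + u /\ ((a k * 2 ^ k + b k) * 2 ^ l).+1 <= b k * 2 ^ k)%N \/
    (exists u, s k = (u + u).+1 /\ (b k * 2 ^ l).+1 <= b k * 2 ^ k + a k * 2 ^ k * 2 ^ l)%N.
Proof.
move=> H; pose c k := (-1) ^+ s k * ((a k)%:R / (b k)%:R) : R.
have E2 k : (2 ^ k)%:R = 2 ^+ k :> R by rewrite natrX.
have -> : r < 2 ^- l <-> exists k, c k + 2 ^- k < 2 ^- l.
  split=> [lt|[k]]; last first.
    by apply: le_lt_trans; have [_] := H k; rewrite -/(c k) ler_norml; lra.
  (* Half the gap, because the error counts twice: once in [c k] and once in the added [2 ^- k]. *)
  have [k Hk] : exists k, 2 ^- k < (2 ^- l - r) / 2 by apply: exp2V_lt; lra.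
  by exists k; have [_] := H k; rewrite -/(c k) ler_norml; lra.
have b0 k : 0 < (b k)%:R :> R by rewrite ltr0n lt0n; apply/eqP; case: (H k).
have p0 k : 0 < 2 ^+ k :> R by rewrite exprn_gt0.
have even k u : s k = (u + u)%N ->
    (c k + 2 ^- k < 2 ^- l) = ((a k * 2 ^ k + b k) * 2 ^ l < b k * 2 ^ k)%N.
  move=> Es; rewrite /c Es -signr_odd addnn odd_double mul1r frac_add_lt //.
  by rewrite -(ltr_nat R) !(natrM, natrD) !E2.
have odd k u : s k = (u + u).+1 ->
    (c k + 2 ^- k < 2 ^- l) = (b k * 2 ^ l < b k * 2 ^ k + a k * 2 ^ k * 2 ^ l)%N.
  move=> Es; rewrite /c Es -signr_odd addnn /= odd_double expr1 mulN1r -mulNr frac_add_lt //.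
  rewrite -(ltr_nat R) !(natrM, natrD) !E2 -[RHS]subr_gt0 -[LHS]subr_gt0.
  by congr (_ < _); ring.
split=> -[k Hk]; exists k; last first.
  by case: Hk => -[u [Es]]; rewrite ?(even _ _ Es) ?(odd _ _ Es).
have := odd_double_half (s k); rewrite -addnn; case: (ssrnat.odd (s k)) => Es.
  by right; exists (s k)./2; rewrite -(odd _ _ (esym Es)).
by left; exists (s k)./2; rewrite -(even _ _ (esym Es)).
Qed.

Lemma implicit_lt_exp2V (r : nat -> nat -> R) : computable_double_seq r ->
  implicit (fun i j l => r i j < 2 ^- l).
Proof.
move=> [s [a [b [/implicit_seq Hs /implicit_seq Ha /implicit_seq Hb Hr]]]].
have Hp := implicit_exp2.
(* [N'] and [N] are the Cantor codes of [(i, j)] and of [(N', k)]. *)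
pose Q (X : baire) i j l := exists k N N', (N' + N' = (i + j).+1 * (i + j) + (j + j) /\
   N + N = (N' + k).+1 * (N' + k) + (k + k) /\
  ((exists u, X (tup 0 0 N 0) = u + u /\
     ((X (tup 1 0 N 0) * X (tup 3 k 0 0) + X (tup 2 0 N 0)) * X (tup 3 l 0 0)).+1 <=
     X (tup 2 0 N 0) * X (tup 3 k 0 0)) \/
   (exists u, X (tup 0 0 N 0) = (u + u).+1 /\
     (X (tup 2 0 N 0) * X (tup 3 l 0 0)).+1 <= X (tup 2 0 N 0) * X (tup 3 k 0 0) +
     X (tup 1 0 N 0) * X (tup 3 k 0 0) * X (tup 3 l 0 0))))%N.
apply: (@implicit_graph [:: fun _ k _ => s k; fun _ k _ => a k; fun _ k _ => b k;
    fun x _ _ => 2 ^ x]%N _ (fun X i j l v => (v = 1 /\ Q X i j l) \/ (v = 0 /\ ~ Q X i j l))%N).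
- by move=> [[|[|[|[|//]]]] /= _].
- by rewrite /Q /=; definability.
move=> X HX i j l v; have -> : Q X i j l <-> r i j < 2 ^- l.
  rewrite (lt_exp2V_approx l (Hr i j)); split=> -[k].
    move=> [N [N' [/cantor_pairE <- [/cantor_pairE <-]]]].
    by rewrite !(HX 0%N) // !(HX 1%N) // !(HX 2%N) // !(HX 3%N) //=; exists k.
  move=> H; exists k, (cantor_pair (cantor_pair i j) k), (cantor_pair i j).
  do 2!(split; first exact/cantor_pairE).
  by rewrite !(HX 0%N) // !(HX 1%N) // !(HX 2%N) // !(HX 3%N).
by case: (r i j < _); split=> [[[->]|[->]]|<-] //; [left|right].
Qed.

End RealBounds.

(** [v = j.+1] for the least [j] with [C s l c j] when [k = 2l + 3], and [v = 0]
    otherwise.  Block [2l + 3] of [interleave q p] holds [p l.+1], whose point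
    is within [2 ^- l.+1] of the named one. *)
Definition least_index (C : nat -> nat -> nat -> nat -> Prop) (s k c v : nat) : Prop :=
  (exists l, k = l + l + 3 /\
     ((exists j, v = j.+1 /\ C s l c j /\ forall j', j'.+1 <= j -> ~ C s l c j') \/
      (v = 0 /\ forall j, ~ C s l c j))) \/
  (v = 0 /\ ~ exists l, k = l + l + 3).

Lemma least_index_table C : exists w : nat -> nat -> nat -> nat,
  forall s k c v, least_index C s k c v <-> w s k c = v.
Proof.
have ex (t : nat * nat * nat) : exists v, least_index C t.1.1 t.1.2 t.2 v.
  case: t => [[s k] c] /=; have [[l ->]|H] := pselect (exists l, k = l + l + 3); last first.
    by exists 0; right.
  have [Hj|H] := pselect (exists j, C s l c j); last first.
    by exists 0; left; exists l; split=> //; right; split=> // j Hj; apply: H; exists j.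
  have Hj' : exists j, `[< C s l c j >] by case: Hj => j /asboolP; exists j.
  case: (ex_minnP Hj') => j /asboolP Cj min_j; exists j.+1; left; exists l; split=> //.
  by left; exists j; split=> //; split=> // j' lt_j /asboolP /min_j; rewrite leqNgt lt_j.
have uniq s k c v v' : least_index C s k c v -> least_index C s k c v' -> v = v'.
  have dbl l l' : l + l + 3 = l' + l' + 3 -> l = l' by lia.
  move=> [[l [-> H]]|[-> H]] [[l' [E H']]|[-> H']] //; first last.
  - by case: H; exists l'.
  - by case: H'; exists l.
  move/dbl: E => E; subst l'.
  move: H H' => [[j [-> [Cj Mj]]]|[-> Nj]] [[j' [-> [Cj' Mj']]]|[-> Nj']] //.
  - by congr _.+1; case: (ltngtP j j') => // [/Mj'|/Mj].
  - by case: (Nj' j).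
  - by case: (Nj j').
have /choice[w Hw] := ex; exists (fun s k c => w (s, k, c)) => s k c v.
by split=> [H|<-]; [exact: uniq (Hw (s, k, c)) H|exact: (Hw (s, k, c))].
Qed.

(** The criterion uses only comparisons of distances in the domain ([p]) and range ([o]) and the
    names [r], with one number quantifier; minimality makes the selected index unique. *)
Lemma implicit_search (p : nat -> nat -> nat -> bool) (o : nat -> nat -> nat -> bool) r :
  implicit p -> implicit o -> implicit (fun n k _ => r n k) ->
  exists w, implicit w /\ forall s k c v, least_index
    (fun s l i j => forall n, p n i l -> o (r n s.+4.+1) j s.+3) s k c v <-> w s k c = v.
Proof.
move=> Hp Ho Hr; pose C s l i j := forall n, p n i l -> o (r n s.+4.+1) j s.+3.
have [w Hw] := least_index_table C.
exists w; split=> //.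
pose D (X : baire) s l i j := forall n, X (tup 0 n i l) = 1 ->
  X (tup 1 (X (tup 2 n s.+4.+1 0)) j s.+3) = 1.
apply: (@implicit_graph [:: fun x y z => p x y z : nat; fun x y z => o x y z : nat;
  fun n k _ => r n k] _ (fun X s k c v => least_index (D X) s k c v)).
- by move=> [[|[|[|//]]] /= _].
- by rewrite /least_index /D /=; definability.
- move=> X HX s k c v; rewrite -Hw; have -> // : D X = C.
  have E (b : bool) : nat_of_bool b = 1 <-> b by case: b.
  do 4!apply/funext=> ?; apply/propext; split=> H n; move: (H n);
    by rewrite (HX 0) // (HX 1) // (HX 2) //= => K /E /K /E.
Qed.

Local Open Scope classical_set_scope.
Local Open Scope ring_scope.

(** * Distances and Cauchy names *)

Section MetricNames.
Variables (R : realType) (T : metricType R).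

Lemma exp2VS k : 2 ^- k.+1 = 2 ^- k / 2 :> R.
Proof. by rewrite exprS invfM mulrC. Qed.

Lemma exp2V_gt0 k : 0 < 2 ^- k :> R.
Proof. by rewrite invr_gt0 exprn_gt0. Qed.

Lemma exp2V_le k n : (k <= n)%N -> 2 ^- n <= 2 ^- k :> R.
Proof. by move=> le_kn; rewrite lef_pV2 ?posrE ?exprn_gt0 // ler_eXn2l // ltr1n. Qed.

Lemma dense_mdist (alpha : nat -> T) x e : dense (range alpha) -> 0 < e ->
  exists n, mdist x (alpha n) < e.
Proof.
move=> dalpha e0; have [] := dalpha (interior (ball x e)).
- by exists x; exact: nbhsx_ballx.
- exact: open_interior.
- move=> y [/interior_subset]; rewrite ballEmdist /= => lt_y [n _ En].
  by exists n; rewrite En.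
Qed.

Lemma cauchy_name_mdist (alpha : nat -> T) p x k : cauchy_name alpha p x ->
  mdist x (alpha (p k)) <= 2 ^- k.
Proof.
move=> [Hp /metricType_numDomainType.cvgrPdist_lt Hx]; apply/ler_addgt0Pr => e e0.
have [N _ HN] := Hx _ e0; have := HN (maxn N k) (leq_maxl _ _).
have := Hp k (maxn N k) (leq_maxr _ _).
have := metric_triangle x (alpha (p (maxn N k))) (alpha (p k)).
by move=> /= A B C; lra.
Qed.

Lemma cauchy_name_const (alpha : nat -> T) n : cauchy_name alpha (fun=> n) (alpha n).
Proof.
split=> [k m _|]; first by rewrite mdistxx exp2V_gt0.
exact: cvg_cst.
Qed.

(** Two errors of at most [2 ^- k.+2] stay strictly below [2 ^- k]. *)
Lemma cauchy_name_near (alpha : nat -> T) r x :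
  (forall k, mdist x (alpha (r k)) <= 2 ^- k.+2) -> cauchy_name alpha r x.
Proof.
move=> Hr; split=> [k n le_kn|].
  have := metric_triangle (alpha (r n)) x (alpha (r k)).
  have := Hr n; have := Hr k; have := exp2V_le le_kn; have := exp2V_gt0 k.
  by rewrite [mdist (alpha (r n)) x]metric_sym !exp2VS; lra.
apply/metricType_numDomainType.cvgrPdist_lt => e e0; have [N HN] := exp2V_lt e0; exists N => // n /= le_n.
have := Hr n; have := exp2V_le le_n; have := exp2V_gt0 n; rewrite !exp2VS; lra.
Qed.

End MetricNames.

(** * Soundness and completeness of the search *)

Section Main.
Variables (R : realType) (X Y : metricType R) (alpha : nat -> X) (beta : nat -> Y) (f : X -> Y).
Hypotheses (dalpha : dense (range alpha)) (dbeta : dense (range beta)) (hcont : continuous f).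
Variable r : nat -> baire.
Hypothesis Hr : forall n, cauchy_name beta (r n) (f (alpha n)).

Let C s l i j := forall n, mdist (alpha n) (alpha i) < 2 ^- l ->
  mdist (beta (r n s.+4.+1)) (beta j) < 2 ^- s.+3.

Lemma continuous_mdist x e : 0 < e ->
  exists2 d, 0 < d & forall y, mdist x y < d -> mdist (f x) (f y) < e.
Proof.
move=> e0; have /metricType_numDomainType.cvgrPdist_lt/(_ _ e0)/metricType_numDomainType.nbhs_mdistP[d d0 Hd] := @hcont x.
by exists d => // y /Hd.
Qed.

(** A dense point close to [x] lies in the tested ball and has its value close to [f x]. The errors
    are two of [2 ^- s.+4.+1] and one of [2 ^- s.+3], which stay below [2 ^- s.+2]. *)
Lemma search_sound p x s l j : cauchy_name alpha p x -> C s l (p l.+1) j ->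
  mdist (f x) (beta j) <= 2 ^- s.+2.
Proof.
move=> /cauchy_name_mdist Hp HC.
have [d d0 Hd] := continuous_mdist x (exp2V_gt0 R s.+4.+1).
have [n Hn] : exists n, mdist x (alpha n) < Num.min d (2 ^- l.+1).
  by apply: dense_mdist => //; rewrite lt_min d0 exp2V_gt0.
move: Hn; rewrite lt_min => /andP[/Hd H1 H2].
(* Both [alpha n] and [alpha (p l.+1)] are within [2 ^- l.+1] of [x]. *)
have /HC H3 : mdist (alpha n) (alpha (p l.+1)) < 2 ^- l.
  have := metric_triangle (alpha n) x (alpha (p l.+1)); have := Hp l.+1.
  by rewrite [mdist (alpha n) x]metric_sym; move: H2; rewrite exp2VS; lra.
have H4 := cauchy_name_mdist s.+4.+1 (Hr n).
have T1 := metric_triangle (f x) (f (alpha n)) (beta j).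
have T2 := metric_triangle (f (alpha n)) (beta (r n s.+4.+1)) (beta j).
have := exp2V_gt0 R s; move: H1 H3 H4; rewrite !exp2VS; lra.
Qed.

(** By continuity all small balls around the approximations map close to [f x], so a [beta j] near
    [f x] passes the test: three errors of [2 ^- s.+4.+1] stay below [2 ^- s.+3]. It holds for all
    large [l], so blocks missed while printing do no harm. *)
Lemma search_complete p x s : cauchy_name alpha p x ->
  exists k0, forall l, (k0 <= l)%N -> exists j, C s l (p l.+1) j.
Proof.
move=> /cauchy_name_mdist Hp.
have [d d0 Hd] := continuous_mdist x (exp2V_gt0 R s.+4.+1).
have [k0 Hk0] : exists k, 2 ^- k < d / 2 by apply: exp2V_lt; lra.
have [j Hj] := dense_mdist (f x) dbeta (exp2V_gt0 R s.+4.+1).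
exists k0 => l /(exp2V_le R) le_l; exists j => n Hn.
have /Hd H1 : mdist x (alpha n) < d.
  have := metric_triangle x (alpha (p l.+1)) (alpha n); have := Hp l.+1.
  have := exp2V_gt0 R l.
  by rewrite [mdist (alpha (p _)) _]metric_sym exp2VS; move: Hn; lra.
have H4 := cauchy_name_mdist s.+4.+1 (Hr n).
have T1 := metric_triangle (beta (r n s.+4.+1)) (f (alpha n)) (beta j).
have T2 := metric_triangle (f (alpha n)) (f x) (beta j).
rewrite [mdist (f (alpha n)) (f x)]metric_sym in T2.
rewrite [mdist (beta _) (f (alpha n))]metric_sym in T1.
have := exp2V_gt0 R s; move: H1 Hj H4; rewrite !exp2VS; lra.
Qed.

End Main.

Theorem corollary6p5 (R : realType) (X Y : metricType R)
    (alpha : nat -> X) (beta : nat -> Y)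
    (hX : computable_metric alpha) (hY : computable_metric beta)
    (hcomplete : complete X)
    (f : X -> Y)
    (hlim : limit_computable_map alpha beta f)
    (hcont : continuous f) :
  exists q : baire,
    hyperarithmetical q /\ computable_map_rel q alpha beta f.
Proof.
case: hX hY => dalpha /implicit_lt_exp2V HpX [dbeta /implicit_lt_exp2V HpY].
case: hlim => F [HF [M HM]].
(* The constant sequence [n] is a name of [alpha n]. *)
have /choice[r Hr] : forall n, exists r, F (fun=> n) = Some r /\ cauchy_name beta r (f (alpha n)).
  by move=> n; have [r] := HF _ _ (cauchy_name_const alpha n); exists r.
have Hname n : cauchy_name beta (r n) (f (alpha n)) by case: (Hr n).
have Himp : implicit (fun n k _ => r n k).
  by apply: (@implicit_produced M) => n; apply: HM; case: (Hr n).
have [w [Hw Ew]] := implicit_search HpX HpY Himp.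
have [q [Hq Eq]] := transition_table Hw.
exists q; split; first exact: hyperarithmetical_implicit.
pose good z t := produces transducer_machine z t /\ forall i, exists k, w i k (z k) = (t i).+1.
(* [G] chooses a good [t]; goodness includes being produced by the machine, which therefore computes
   [G]. *)
pose G : pfun_baire := fun z =>
  if pselect (exists t, good z t) is left e then Some (sval (cid e)) else None.
exists (fun p => G (interleave q p)); split; last first.
  exists G; split=> //; exists transducer_machine; split; first exact: transducer_one_way.
  by move=> z t; rewrite /G; case: pselect => // e [<-]; case: (svalP (cid e)).
move=> p x Hp; have Ez l : interleave q p l.*2.+3 = p l.+1.
  by rewrite /interleave /= odd_double uphalf_double.
have [t Ht] : exists t, good (interleave q p) t.
  apply: (transducer_correct Eq) => [n|s]; first by rewrite /interleave odd_double doubleK.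
  have [k0 Hk0] := search_complete dbeta hcont Hname s Hp.
  (* A zero entry at block [2l + 3] would exclude every index, including [j]. *)
  exists k0 => l /Hk0[j Hj]; rewrite Ez => /Ew[[l' [E [[j' [//]]|[_ /(_ j)]]]]|[_]].
    by have -> : l' = l by lia.
  by case; exists l; lia.
rewrite /G; case: pselect => [e|[]]; last by exists t.
exists (sval (cid e)) => //; case: (svalP (cid e)) => _ He.
apply: cauchy_name_near => i; have [k /Ew] := He i.
move=> [[l [-> [[j [[<-] [HC _]]]|[//]]]]|[//]].
apply: (search_sound dalpha hcont Hname Hp (l := l)).
by move: HC; rewrite (_ : (l + l + 3)%N = l.*2.+3) ?Ez //; lia.
Qed.
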